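(* Let $M$ denote a monoid, with submonoids $E,G,G_L,G_R,G_{LR},F,F_L,F_R,F_{LR}$, poset $\mathscr L(M)$ and type $\mathsf T(M)$ as defined in the context. Write $1$ for the trivial submonoid $\{1_M\}$. (i) If $M$ has a stable identity, then $\mathsf T(M)=(1,i,j,k)$ for some $i,j,k\in\{0,1\}$, $G=G_L=G_R=G_{LR}$, $F=F_L=F_R=F_{LR}$, $\mathscr L(M)=\{1,E,G,F,M\}$, and, according to the type, $\mathscr L(M)$ (ordered by inclusion) is as follows, where distinct names not said to be equal denote distinct submonoids: - $(1,0,0,0)$: five distinct elements with $1\subsetneq G\subsetneq F\subsetneq M$, $1\subsetneq E\subsetneq F$, and $G,E$ incomparable; - $(1,0,0,1)$: the chain $1=G\subsetneq E=F\subsetneq M$; - $(1,0,1,0)$: the chain $1=E\subsetneq G=F\subsetneq M$; - $(1,0,1,1)$: the chain $1=E=G=F\subsetneq M$; - $(1,1,0,0)$: four distinct elements with $1\subsetneq G\subsetneq F=M$, $1\subsetneq E\subsetneq F=M$, and $G,E$ incomparable; - $(1,1,0,1)$: the chain $1=G\subsetneq E=F=M$; - $(1,1,1,0)$: the chain $1=E\subsetneq G=F=M$; - $(1,1,1,1)$: $1=E=G=F=M$. (ii) If $M$ has an unstable identity, then $\mathsf T(M)=(0,i,j,k)$ for some $i,j,k\in\{0,1\}$, and among the eleven names $1,E,G,G_L,G_R,G_{LR},F,F_L,F_R,F_{LR},M$ the only coincidences are: $M=F_{LR}$ exactly when $i=1$; $F_{LR}=G_{LR}$ exactly when $j=1$;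 $G=1$ and $F=E$ exactly when $k=1$ (and those following from these by transitivity of equality). The inclusion order on $\mathscr L(M)$ is the reflexive-transitive closure of the inclusions $1\subseteq G$, $1\subseteq E$, $E\subseteq F$, $G\subseteq G_L$, $G\subseteq G_R$, $G\subseteq F$, $G_L\subseteq G_{LR}$, $G_R\subseteq G_{LR}$, $G_L\subseteq F_L$, $G_R\subseteq F_R$, $F\subseteq F_L$, $F\subseteq F_R$, $F_L\subseteq F_{LR}$, $F_R\subseteq F_{LR}$, $G_{LR}\subseteq F_{LR}$, $F_{LR}\subseteq M$. Denote the resulting lattice (which depends only on $i,j,k$) by $\Lambda_{i,j,k}$. (iii) Each of the sixteen lattices described in (i) and (ii) (eight for the types $(1,i,j,k)$ and eight for the types $(0,i,j,k)$) arises as $\mathscr L(M)$ for some monoid $M$. (iv) Up to isomorphism, for every monoid $M$ the lattice $\mathscr L(M)$ is one of the following: the one-element lattice; the two-element chain; the three-element chain; the four-element lattice $2\times 2$ (two incomparable elements between a bottom and a top); the five-element lattice obtained from $2\times2$ by adjoining a new top element; or one of the eight lattices $\Lambda_{i,j,k}$ with $i,j,k\in\{0,1\}$.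
   Context: All submonoids of a monoid $M$ contain its identity $1=1_M$. An element $x\in M$ is a left unit if $ax=1$ for some $a\in M$, a right unit if $xa=1$ for some $a\in M$, and a unit if it is both. $\langle A\rangle$ denotes the submonoid generated by $A$. Define submonoids of $M$: $E$ is generated by all idempotents of $M$; $G_L$ is the set of all left units; $G_R$ the set of all right units; $G=G_L\cap G_R$ the group of units; $G_{LR}=\langle G_L\cup G_R\rangle$; $F=\langle E\cup G\rangle$; $F_L=\langle E\cup G_L\rangle$; $F_R=\langle E\cup G_R\rangle$; $F_{LR}=\langle E\cup G_L\cup G_R\rangle$. Set $\mathscr L(M)=\{\{1\},E,G,G_L,G_R,G_{LR},F,F_L,F_R,F_{LR},M\}$, ordered by inclusion (this is a lattice). The type of $M$ is $\mathsf T(M)=(t_1,t_2,t_3,t_4)\in\{0,1\}^4$, where $t_1=1$ iff $G=G_L$; $t_2=1$ iff $F_{LR}=M$; $t_3=1$ iff $F_{LR}=G_{LR}$; $t_4=1$ iff $G=\{1\}$. Green's relations on $M$: $x\mathrel{\mathscr L}y\iff Mx=My$; $x\mathrel{\mathscr R}y\iff xM=yM$; $x\mathrel{\mathscr J}y\iff MxM=MyM$. An element $x\in M$ is stable if for all $a\in M$: $ax\mathrel{\mathscr J}x$ implies $ax\mathrel{\mathscr L}x$, and $xa\mathrel{\mathscr J}x$ implies $xa\mathrel{\mathscr R}x$. Otherwise $x$ is unstable. ''$M$ has a stable (unstable) identity'' means that $1$ is stable (unstable). *)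

(* Defs.v *)
From Stdlib Require Export Relations.Relation_Operators.
From mathcomp Require Export all_boot.
From mathcomp Require Export boolp classical_sets functions.

Set Implicit Arguments.
Unset Strict Implicit.
Unset Printing Implicit Defensive.

Local Open Scope classical_set_scope.
Local Open Scope group_scope.

(* A [monoidType] carries a choice structure; classically every type has one
   ([boolp.gen_eqMixin], [boolp.gen_choiceMixin]), so these are arbitrary
   monoids. *)

Section Submonoids.
Variable M : monoidType.

Definition submonoid (A : set M) : Prop :=
  A 1 /\ (forall x y, A x -> A y -> A (x * y)).

Definition gen (A : set M) : set M := smallest submonoid A.

Definition E : set M := gen [set e | e * e = e].
Definition GL : set M := [set x | exists a, a * x = 1].
Definition GR : set M := [set x | exists a, x * a = 1].
Definition G : set M := GL `&` GR.
Definition GLR : set M := gen (GL `|` GR).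
Definition F : set M := gen (E `|` G).
Definition FL : set M := gen (E `|` GL).
Definition FR : set M := gen (E `|` GR).
Definition FLR : set M := gen (E `|` GL `|` GR).

Definition mtype : bool * bool * bool * bool :=
  (`[< G = GL >], `[< FLR = setT >], `[< FLR = GLR >], `[< G = [set 1] >]).

Definition greenL (x y : M) : Prop :=
  [set a * x | a in setT] = [set a * y | a in setT].
Definition greenR (x y : M) : Prop :=
  [set x * a | a in setT] = [set y * a | a in setT].
Definition greenJ (x y : M) : Prop :=
  [set z | exists a b, z = a * x * b] = [set z | exists a b, z = a * y * b].

Definition stable (x : M) : Prop :=
  forall a, (greenJ (a * x) x -> greenL (a * x) x) /\
            (greenJ (x * a) x -> greenR (x * a) x).

Definition stable_identity : Prop := stable 1.
Definition unstable_identity : Prop := ~ stable 1.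

End Submonoids.

Arguments E M : clear implicits.
Arguments GL M : clear implicits.
Arguments GR M : clear implicits.
Arguments G M : clear implicits.
Arguments GLR M : clear implicits.
Arguments F M : clear implicits.
Arguments FL M : clear implicits.
Arguments FR M : clear implicits.
Arguments FLR M : clear implicits.
Arguments mtype M : clear implicits.
Arguments stable_identity M : clear implicits.
Arguments unstable_identity M : clear implicits.

Inductive name :=
  N1 | NE | NG | NGL | NGR | NGLR | NF | NFL | NFR | NFLR | NM.

Definition named (M : monoidType) (a : name) : set M :=
  match a with
  | N1 => [set 1]
  | NE => E M
  | NG => G M
  | NGL => GL M
  | NGR => GR M
  | NGLR => GLR M
  | NF => F M
  | NFL => FL M
  | NFR => FR M
  | NFLR => FLR M
  | NM => setT
  end.

Arguments named M a : clear implicits.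

Definition LL (M : monoidType) : set (set M) := range (named M).

Arguments LL M : clear implicits.

(* The labelled lattice attached to the type (1,i,j,k). *)
Definition stable_diagram (M : monoidType) (i j k : bool) : Prop :=
  let I := [set 1 : M] in
  let E := E M in
  let G := G M in
  let F := F M in
  let T := [set: M] in
  match i, j, k with
  | false, false, false =>
      [/\ I `<` G, G `<` F & F `<` T] /\ (I `<` E /\ E `<` F) /\
      (~ (G `<=` E) /\ ~ (E `<=` G))
  | false, false, true => [/\ I = G, G `<` E, E = F & F `<` T]
  | false, true, false => [/\ I = E, E `<` G, G = F & F `<` T]
  | false, true, true => [/\ I = E, E = G, G = F & F `<` T]
  | true, false, false =>
      [/\ I `<` G, G `<` F & F = T] /\ (I `<` E /\ E `<` F) /\
      (~ (G `<=` E) /\ ~ (E `<=` G))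
  | true, false, true => [/\ I = G, G `<` E, E = F & F = T]
  | true, true, false => [/\ I = E, E `<` G, G = F & F = T]
  | true, true, true => [/\ I = E, E = G, G = F & F = T]
  end.

Definition stable_lattice (M : monoidType) (i j k : bool) : Prop :=
  [/\ [/\ G M = GL M, GL M = GR M & GR M = GLR M],
      [/\ F M = FL M, FL M = FR M & FR M = FLR M],
      LL M = [set [set 1]; E M; G M; F M; setT]
    & stable_diagram M i j k].

Inductive Lambda_coincidence (i j k : bool) : name -> name -> Prop :=
  | coinc_M_FLR : i -> Lambda_coincidence i j k NM NFLR
  | coinc_FLR_GLR : j -> Lambda_coincidence i j k NFLR NGLR
  | coinc_G_1 : k -> Lambda_coincidence i j k NG N1
  | coinc_F_E : k -> Lambda_coincidence i j k NF NE.

Inductive Lambda_inclusion : name -> name -> Prop :=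
  | incl_1_G : Lambda_inclusion N1 NG
  | incl_1_E : Lambda_inclusion N1 NE
  | incl_E_F : Lambda_inclusion NE NF
  | incl_G_GL : Lambda_inclusion NG NGL
  | incl_G_GR : Lambda_inclusion NG NGR
  | incl_G_F : Lambda_inclusion NG NF
  | incl_GL_GLR : Lambda_inclusion NGL NGLR
  | incl_GR_GLR : Lambda_inclusion NGR NGLR
  | incl_GL_FL : Lambda_inclusion NGL NFL
  | incl_GR_FR : Lambda_inclusion NGR NFR
  | incl_F_FL : Lambda_inclusion NF NFL
  | incl_F_FR : Lambda_inclusion NF NFR
  | incl_FL_FLR : Lambda_inclusion NFL NFLR
  | incl_FR_FLR : Lambda_inclusion NFR NFLR
  | incl_GLR_FLR : Lambda_inclusion NGLR NFLR
  | incl_FLR_M : Lambda_inclusion NFLR NM.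

Definition Lambda_eq (i j k : bool) : name -> name -> Prop :=
  clos_refl_sym_trans _ (Lambda_coincidence i j k).

(* A preorder on the eleven names: the coincident names are allowed as steps,
   so that it is the closure of the inclusions on the identified names. *)
Definition Lambda_le (i j k : bool) : name -> name -> Prop :=
  clos_refl_trans _ (fun a b => Lambda_inclusion a b \/ Lambda_eq i j k a b).

Definition unstable_lattice (M : monoidType) (i j k : bool) : Prop :=
  (forall a b, named M a = named M b <-> Lambda_eq i j k a b) /\
  (forall a b, named M a `<=` named M b <-> Lambda_le i j k a b).

(* The lattice itself: its elements are the classes of coincident names. *)
Definition Lambda (i j k : bool) : set (set name) :=
  range (fun a => [set b | Lambda_eq i j k a b]).
Definition Lambda_order (i j k : bool) (A B : set name) : Prop :=
  exists a b, [/\ A a, B b & Lambda_le i j k a b].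

(* An order isomorphism; between lattices this is a lattice isomorphism. *)
Definition order_iso (T U : Type) (A : set T) (leA : T -> T -> Prop)
    (B : set U) (leB : U -> U -> Prop) : Prop :=
  exists f : T -> U, set_bij A B f /\
    (forall x y, A x -> A y -> (leA x y <-> leB (f x) (f y))).

Definition chain_le (n : nat) (x y : 'I_n) : Prop := (x <= y)%N.

Definition square_le (x y : bool * bool) : Prop :=
  (x.1 -> y.1) /\ (x.2 -> y.2).

(* [None] is the new top. *)
Definition add_top_le (T : Type) (le : T -> T -> Prop) (x y : option T) : Prop :=
  match x, y with
  | _, None => True
  | None, Some _ => False
  | Some x', Some y' => le x' y'
  end.

Definition LL_iso (M : monoidType) (U : Type) (B : set U)
    (leB : U -> U -> Prop) : Prop :=
  order_iso (LL M) (fun X Y => X `<=` Y) B leB.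

(* Main.v *)
From HB Require Import structures.
From mathcomp Require Import zify.
Require Import Defs.

(** Write the eleven names in the order of the diagram of part (ii); it is a
    distributive lattice whose join-irreducible names are G, E, GL, GR and M.
    Each of these five is join-prime, so it splits the diagram in two: a name
    that is not above G is below E, and similarly for the pairs (E, GLR),
    (GL, FR), (GR, FL) and (M, FLR). Hence all that separates two names in a
    monoid is a failure of one of the five inclusions

      G <= E,   E <= GLR,   GL <= FR,   GR <= FL,   M <= FLR,

    and these are governed by the type. The point is that in a product
    equal to a left unit the last factor is a left unit, that in a product
    equal to a right unit the first factor is a right unit, and that a
    one-sided unit which is idempotent is 1. By induction on products this
    yields E & GL = {1} (so G <= E iff G = {1}) and FR & GL = G (so GL <= FR
    iff GL = G), with their left-right duals ([E_GL], [E_GR], [FR_GL],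
    [FL_GR]); moreover E <= GLR iff FLR = GLR. The identity is stable iff
    GL = G iff GR = G ([stableP], [GL_eq_GR]).

    When GL <> G, two of the splittings are always effective, and the other
    three according to the type; if FLR = GLR the name E still has to be
    separated from GL and GR, which is done by the idempotent x * a, where
    a * x = 1 and x is not a unit. This is [sub_unstable_le]. When GL = G, the
    diagram folds onto 1, E, G, F, M, and what remains is a finite comparison
    ([sub_stable_le], [stable_le_sub]). In both cases the order on the names is
    a function of the type, so that the isomorphism type of the lattice is read
    off from a table.

    For the existence part, units, idempotents and generated submonoids of a
    direct product are computed componentwise, so types multiply: the type of
    A * B is the componentwise conjunction of the types of A and B
    ([mtype_prod]). It then suffices to realize one vanishing coordinate at a
    time: the additive monoid of natural numbers, the two-element semilattice
    and the two-element group account for the last three, and the bicyclic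
    monoid, of type (0,1,1,1), for the first. *)

Set Implicit Arguments.
Unset Strict Implicit.
Unset Printing Implicit Defensive.

Local Open Scope classical_set_scope.
Local Open Scope group_scope.

(** * Generated submonoids *)

Section Generation.
Variable M : monoidType.
Implicit Types S T P : set M.

Lemma gen_submonoid S : submonoid (gen S).
Proof.
split=> [A [[A1 _] _] //|x y Sx Sy A AS].
by have [[_ AM] _] := AS; apply: AM; [apply: Sx|apply: Sy].
Qed.

Lemma gen1 S : gen S 1.
Proof. by have [] := gen_submonoid S. Qed.

Lemma genM S x y : gen S x -> gen S y -> gen S (x * y).
Proof. by have [_] := gen_submonoid S; apply. Qed.

Lemma sub_gen S : S `<=` gen S.
Proof. exact: sub_gen_smallest. Qed.

Lemma gen_sub S T : S `<=` gen T -> gen S `<=` gen T.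
Proof. by move=> ST; apply: smallest_sub ST; apply: gen_submonoid. Qed.

(** Every element of [gen S] is a product of elements of [S], read from the left;
    this is the form in which the first and the last factor of such a product
    can be compared with one-sided units. *)
Lemma gen_ind S P : P 1 ->
  (forall s x, S s -> P x -> P (s * x)) -> gen S `<=` P.
Proof.
move=> P1 PM x Sx; rewrite -[x]mulg1.
suff: gen S `<=` [set z | forall y, P y -> P (z * y)] by apply.
apply: smallest_sub => [|s Ss y]; last exact: PM.
split=> [y|z t Pz Pt y Py]; first by rewrite mul1g.
by rewrite -mulgA; apply/Pz/Pt.
Qed.

End Generation.

(** * One-sided units in products *)

Section Units.
Variable M : monoidType.
Implicit Types x y s : M.

Lemma GL_submonoid : submonoid (GL M).
Proof.
split=> [|x y [a ax] [b yb]]; first by exists 1; rewrite mulg1.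
by exists (b * a); rewrite mulgA -[b * a * x]mulgA ax mulg1.
Qed.

Lemma GR_submonoid : submonoid (GR M).
Proof.
split=> [|x y [a ax] [b yb]]; first by exists 1; rewrite mulg1.
by exists (b * a); rewrite mulgA -[x * y * b]mulgA yb mulg1.
Qed.

Lemma GL_right x y : GL M (x * y) -> GL M y.
Proof. by case=> a axy; exists (a * x); rewrite -mulgA. Qed.

Lemma GR_left x y : GR M (x * y) -> GR M x.
Proof. by case=> a xya; exists (y * a); rewrite mulgA. Qed.

Lemma G_inverse x : G M x -> exists y, [/\ G M y, x * y = 1 & y * x = 1].
Proof.
case=> -[a ax] [b xb]; have ab : a = b by rewrite -[a]mulg1 -xb mulgA ax mul1g.
rewrite -ab in xb; exists a; split=> //; split; by exists x.
Qed.

Lemma idem_GL e : e * e = e -> GL M e -> e = 1.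
Proof. by move=> ee [a ae]; rewrite -[e]mul1g -ae -mulgA ee. Qed.

Lemma idem_GR e : e * e = e -> GR M e -> e = 1.
Proof. by move=> ee [a ae]; rewrite -[e]mulg1 -ae mulgA ee. Qed.

(** If a product of idempotents is a left unit, so is the product of all factors
    but the first, which is then 1 by induction; this leaves a single idempotent
    left unit. *)
Lemma E_GL x : E M x -> GL M x -> x = 1.
Proof.
apply: (gen_ind (P := fun x => GL M x -> x = 1)) => // s {}x ss IH sx.
by move: (sx); rewrite (IH (GL_right sx)) mulg1; apply: idem_GL.
Qed.

Lemma E_GR x : E M x -> GR M x -> x = 1.
Proof.
apply: (gen_ind (P := fun x => GR M x -> x = 1)) => // s {}x ss IH sx.
have s1 := idem_GR ss (GR_left sx).
by rewrite s1 mul1g in sx *; apply: IH.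
Qed.

(** Let a product of right units and of elements of [E] be a left unit. The
    product of all factors but the first is a left unit, hence a unit by
    induction; cancelling it, the first factor is a left unit as well. If it is
    in [E] it is 1, and if it is a right unit it is a unit. *)
Lemma FR_GL x : FR M x -> GL M x -> G M x.
Proof.
apply: (gen_ind (P := fun x => GL M x -> G M x)) => [_|s {}x ss IH sx].
  by split; exists 1; rewrite mulg1.
have Gx := IH (GL_right sx); have [y [Gy xy _]] := G_inverse Gx.
have sL : GL M s.
  by rewrite -[s]mulg1 -xy mulgA; apply: GL_submonoid.2 => //; case: Gy.
split=> //; apply: GR_submonoid.2; last by case: Gx.
by case: ss => // /E_GL ->; [exists 1; rewrite mulg1 | ].
Qed.

(** The dual argument: here the first factor is the one known to be a right unit,
    so it is a unit and can be cancelled before the induction hypothesis is used. *)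
Lemma FL_GR x : FL M x -> GR M x -> G M x.
Proof.
apply: (gen_ind (P := fun x => GR M x -> G M x)) => [_|s {}x ss IH sx].
  by split; exists 1; rewrite mulg1.
have sR := GR_left sx.
have Gs : G M s.
  by split=> //; case: ss => // /E_GR ->; [exists 1; rewrite mulg1 | ].
have [y [Gy _ ys]] := G_inverse Gs.
have Gx : G M x.
  by apply: IH; rewrite -[x]mul1g -ys -mulgA; apply: GR_submonoid.2 => //; case: Gy.
by split=> //; apply: GL_submonoid.2; [case: Gs|case: Gx].
Qed.

(** An inverse on one side of an element of [GR] lies in [GL], and conversely. *)
Lemma GL_eq_GR : G M = GL M <-> G M = GR M.
Proof.
split=> GG; apply/seteqP; split=> x; try by case.
  case=> a xa; have /G_inverse[y [Gy ay _]] : G M a by rewrite GG; exists x.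
  by rewrite (_ : x = y) // -[x]mulg1 -ay mulgA xa mul1g.
case=> a ax; have /G_inverse[y [Gy _ ya]] : G M a by rewrite GG; exists x.
by rewrite (_ : x = y) // -[x]mul1g -ya -mulgA ax mulg1.
Qed.

(** An element [a] is J-related to 1 when [u * a * v = 1] for some [u] and [v].
    If [GL = GR] then [u * a] is a unit, and so is [a]. In the other direction, a
    left unit [x] is J-related to 1, so by stability it is R-related to 1. *)
Lemma stableP : stable_identity M <-> G M = GL M.
Proof.
split=> [st|GGL].
  apply/seteqP; split=> x; first by case.
  move=> xL; split=> //; have [a ax] := xL.
  have [_ /(_ _)] := st x; rewrite mul1g => R1.
  have {R1} : greenR x 1.
    apply: R1; apply/seteqP; split=> z [u [v ->]].
      by exists (u * x), v; rewrite mulg1.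
    by exists (u * a), v; rewrite mulg1 -[u * a * x]mulgA ax mulg1.
  move=> /seteqP[_ /(_ 1)][]; first by exists 1; rewrite ?mulg1.
  by move=> b _ xb; exists b.
have GGR : G M = GR M by apply/GL_eq_GR.
move=> a; rewrite mul1g mulg1.
have aG : greenJ a 1 -> G M a.
  move=> /seteqP[_ /(_ 1)][]; first by exists 1, 1; rewrite !mulg1.
  move=> u [v uav].
  have : G M (u * a) by rewrite GGR; exists v.
  by rewrite GGL => /GL_right.
split=> /aG/G_inverse[b [_ ab ba]]; apply/seteqP; split=> _ [z _ <-].
- by exists (z * a); rewrite ?mulg1.
- by exists (z * b); rewrite // -mulgA ba.
- by exists (a * z); rewrite ?mul1g.
- by exists (b * z); rewrite // mulgA ab.
Qed.

End Units.

(** * The order on names *)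

Definition covers (a : name) : seq name :=
  match a with
  | N1 => [:: NE; NG]
  | NE => [:: NF]
  | NG => [:: NGL; NGR; NF]
  | NGL => [:: NGLR; NFL]
  | NGR => [:: NGLR; NFR]
  | NGLR => [:: NFLR]
  | NF => [:: NFL; NFR]
  | NFL | NFR => [:: NFLR]
  | NFLR => [:: NM]
  | NM => [::]
  end.

(** Only the downward direction of each coincidence is recorded: the upward one
    follows from [covers]. *)
Definition collapse (i j k : bool) (a : name) : seq name :=
  match a with
  | NM => if i then [:: NFLR] else [::]
  | NFLR => if j then [:: NGLR] else [::]
  | NG => if k then [:: N1] else [::]
  | NF => if k then [:: NE] else [::]
  | _ => [::]
  end.

(** The further identifications, again downward, that occur when [GL = G]. *)
Definition stable_collapse (j : bool) (a : name) : seq name :=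
  match a with
  | NGLR => [:: NG]
  | NFLR => [:: NF]
  | NE => if j then [:: N1] else [::]
  | _ => [::]
  end.

Definition name_code (a : name) : nat :=
  match a with
  | N1 => 0 | NE => 1 | NG => 2 | NGL => 3 | NGR => 4 | NGLR => 5
  | NF => 6 | NFL => 7 | NFR => 8 | NFLR => 9 | NM => 10
  end.

Lemma name_code_inj : injective name_code.
Proof. by case; case. Qed.

HB.instance Definition _ := Equality.copy name (inj_type name_code_inj).

(** Search for a path of at most [n] steps: an executable under-approximation of
    the reflexive-transitive closure of [nbr]. *)
Fixpoint reach (nbr : name -> seq name) (n : nat) (a b : name) : bool :=
  (a == b) ||
  if n is n'.+1 then has (fun c => reach nbr n' c b) (nbr a) else false.

Lemma reach_sound (R : name -> name -> Prop) nbr n :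
  (forall a, R a a) -> (forall b a c, R a b -> R b c -> R a c) ->
  (forall a b, b \in nbr a -> R a b) ->
  forall a b, reach nbr n a b -> R a b.
Proof.
move=> refl trans step; elim: n => [|n IH] a b /= /orP[/eqP-> //|//].
by case/hasP => c /step Rac /IH; apply: trans.
Qed.

(** The order of the diagram without coincidences; its height is 5. *)
Definition generic_le : name -> name -> bool := reach covers 5.

Lemma covers_inclusion a b : b \in covers a -> Lambda_inclusion a b.
Proof. by case: a; case: b => //= _; constructor. Qed.

Lemma collapse_coincidence i j k a b :
  b \in collapse i j k a -> Lambda_coincidence i j k a b.
Proof.
by case: i j k a b => -[] [] [] [] //= _; constructor.
Qed.

(** Compare which of the primes [G], [E], [M] lie below; a prime is ignored when
    the type makes its splitting ineffective. The primes [GL] and [GR] are absent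
    since they separate names only when [GL <> G]. *)
Definition stable_le (i j k : bool) (a b : name) : bool :=
  [&& k || (generic_le NG a ==> generic_le NG b),
      j || (generic_le NE a ==> generic_le NE b)
    & i || (generic_le NM a ==> generic_le NM b)].

(** When [FLR = GLR], the prime [E] still separates names, but [GLR] has moved
    above it. *)
Definition above_E (j : bool) (a : name) : bool :=
  generic_le NE a || j && (a == NGLR).

Definition unstable_le (i j k : bool) (a b : name) : bool :=
  [&& k || (generic_le NG a ==> generic_le NG b),
      above_E j a ==> above_E j b,
      generic_le NGL a ==> generic_le NGL b,
      generic_le NGR a ==> generic_le NGR b
    & i || (generic_le NM a ==> generic_le NM b)].

(** Six steps suffice for all the types, as a check of all cases shows. *)
Lemma stable_le_reach i j k a b : stable_le i j k a b ->
  reach (fun c => stable_collapse j c ++ collapse i j k c ++ covers c) 6 a b.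
Proof. by case: i j k a b => -[] [] [] []. Qed.

Lemma unstable_le_reach i j k a b : unstable_le i j k a b ->
  reach (fun c => collapse i j k c ++ covers c) 6 a b.
Proof. by case: i j k a b => -[] [] [] []. Qed.

Lemma unstable_le_Lambda i j k a b : unstable_le i j k a b -> Lambda_le i j k a b.
Proof.
move/unstable_le_reach; apply: reach_sound => [c|d c e|c d].
- exact: rt_refl.
- exact: rt_trans.
rewrite mem_cat => /orP[/collapse_coincidence cd|/covers_inclusion cd]; apply: rt_step.
  by right; apply: rst_step.
by left.
Qed.

(** The least name coincident with the given one. Two iterations are needed for
    [NM], which collapses to [NFLR] and then to [NGLR]. *)
Definition rep (i j k : bool) : name -> name :=
  iter 2 (fun a => head a (collapse i j k a)).

Lemma Lambda_eq_rep i j k a : Lambda_eq i j k a (rep i j k a).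
Proof.
have step c : Lambda_eq i j k c (head c (collapse i j k c)).
  have := @collapse_coincidence i j k c; case: collapse => [|d s] H /=.
    exact: rst_refl.
  by apply/rst_step/H; rewrite inE eqxx.
by apply: rst_trans (step _) _; apply: step.
Qed.

Lemma unstable_le_anti i j k a b :
  unstable_le i j k a b -> unstable_le i j k b a -> Lambda_eq i j k a b.
Proof.
move=> ab ba; apply: rst_trans (Lambda_eq_rep i j k a) _.
suff -> : rep i j k a = rep i j k b by apply: rst_sym; apply: Lambda_eq_rep.
by move: ab ba; case: i j k a b => -[] [] [] [].
Qed.

(** * Inclusions forced by the type *)

Section Inclusions.
Variable M : monoidType.
Implicit Types a b p q : name.

Lemma inclusion_sub a b : Lambda_inclusion a b -> named M a `<=` named M b.
Proof.
have gsub (S T : set M) : S `<=` T -> gen S `<=` gen T.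
  by move=> ST; apply: gen_sub => x /ST; apply: sub_gen.
case=> /= x.
- by move->; split; exists 1; rewrite mulg1.
- by move->; apply: gen1.
- by move=> Ex; apply: sub_gen; left.
- by case.
- by case.
- by move=> Gx; apply: sub_gen; right.
- by move=> Gx; apply: sub_gen; left.
- by move=> Gx; apply: sub_gen; right.
- by move=> Gx; apply: sub_gen; right.
- by move=> Gx; apply: sub_gen; right.
- by apply: gsub => y [|[]]; [left|right].
- by apply: gsub => y [|[]]; [left|right].
- by apply: gsub => y []; left; [left|right].
- by apply: gsub => y []; [left; left|right].
- by apply: gsub => y []; [left; right|right].
- by [].
Qed.

Lemma generic_le_sub a b : generic_le a b -> named M a `<=` named M b.
Proof.
apply: (reach_sound (R := fun a b => named M a `<=` named M b))
  => [c|d c e|c d].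
- exact: subset_refl.
- exact: subset_trans.
by move/covers_inclusion/inclusion_sub.
Qed.

(** The prime [p] and the name [q] split the diagram into the names above [p] and
    those below [q]. If [named M p] is not included in [named M q], an inclusion
    cannot lead from the upper part to the lower one. *)
Lemma splitting p q : (forall b, generic_le p b || generic_le b q) ->
  ~ named M p `<=` named M q ->
  forall a b, named M a `<=` named M b -> generic_le p a ==> generic_le p b.
Proof.
move=> pq npq a b ab; apply/implyP => /generic_le_sub pa.
case/orP: (pq b) => // /generic_le_sub bq.
by case: npq => x /pa/ab/bq.
Qed.

Lemma FLR_eq_GLR : E M `<=` GLR M <-> FLR M = GLR M.
Proof.
split=> [EG|<-]; last exact: (@generic_le_sub NE NFLR).
apply/seteqP; split; last exact: (@generic_le_sub NGLR NFLR).
by apply: gen_sub => x [[/EG|]|] // Gx; apply: sub_gen; [left|right].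
Qed.

Lemma G1_F_eq_E : G M = [set 1] -> F M = E M.
Proof.
move=> G1; apply/seteqP; split; last exact: (@generic_le_sub NE NF).
apply: gen_sub => x [|]; last by rewrite G1 => ->; apply: gen1.
by apply.
Qed.

Lemma G_sub_E : G M `<=` E M -> G M = [set 1].
Proof.
move=> GE; apply/seteqP; split; last exact: (@generic_le_sub N1 NG).
by move=> x Gx; apply: E_GL; [apply: GE|case: Gx].
Qed.

Lemma coincidence_eq i j k a b : mtype M = (`[< G M = GL M >], i, j, k) ->
  Lambda_coincidence i j k a b -> named M a = named M b.
Proof.
case=> <- <- <-; case=> /asboolP //= G1; exact: G1_F_eq_E.
Qed.

End Inclusions.

Section Orders.
Variable M : monoidType.
Implicit Types (a b : name) (i j k t : bool).

(** The three splittings by [G], [E] and [M] are governed by the last three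
    coordinates of the type, whether or not the identity is stable. *)
Lemma sub_stable_le t i j k a b : mtype M = (t, i, j, k) ->
  named M a `<=` named M b -> stable_le i j k a b.
Proof.
case=> _ <- <- <- ab; apply/and3P; split.
- case: asboolP => //= GN1; apply: (splitting (q := NE)) ab; first by case.
  by move=> /G_sub_E.
- case: asboolP => //= FG; apply: (splitting (q := NGLR)) ab; first by case.
  by move=> /FLR_eq_GLR.
- case: asboolP => //= FT; apply: (splitting (q := NFLR)) ab; first by case.
  by move=> TF; apply: FT; apply/seteqP; split.
Qed.

Lemma stable_le_sub i j k a b : mtype M = (true, i, j, k) ->
  stable_le i j k a b -> named M a `<=` named M b.
Proof.
move=> tM; have GGL : G M = GL M by case: tM => /asboolP.
have GGR : G M = GR M by apply/GL_eq_GR.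
move/stable_le_reach.
apply: (reach_sound (R := fun a b => named M a `<=` named M b))
  => [c|d c e|c d].
- exact: subset_refl.
- exact: subset_trans.
rewrite !mem_cat => /or3P[|/collapse_coincidence|/covers_inclusion/inclusion_sub//].
  have GLRG : GLR M `<=` G M.
    apply: smallest_sub; first by rewrite GGL; apply: GL_submonoid.
    by rewrite -GGL -GGR setUid.
  have FLRF : FLR M `<=` F M.
    by rewrite /FLR -GGL -GGR -setUA setUid; apply: subset_refl.
  case: j tM => tM; case: c d => -[] //= _.
  (* Only E <= 1 for type (1,_,1,_) is left: here E <= GLR = GL. *)
  have EG : E M `<=` GLR M by apply/FLR_eq_GLR; case: tM => _ _ /asboolP.
  by move=> x Ex; apply: (E_GL Ex); rewrite -GGL; apply: GLRG; apply: EG.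
move=> cd; rewrite (coincidence_eq _ cd) // tM.
by congr (_, _, _, _); apply/esym/asboolP.
Qed.

(** If [a * x = 1] then [x * a] is idempotent, and it equals 1 only if [x] is a
    unit. *)
Lemma nontrivial_idem : G M <> GL M -> exists2 e, E M e & e <> 1.
Proof.
move=> GGL; apply: contrapT => noe; apply: GGL; apply/seteqP; split=> x.
  by case.
move=> xL; split=> //; have [a ax] := xL; exists a; apply: contrapT => xa.
apply: noe; exists (x * a) => //; apply: sub_gen.
by rewrite /= mulgA -[x * a * x]mulgA ax mulg1.
Qed.

(** The splittings by [GL] and [GR] are effective as soon as [GL <> G], since
    [FR] meets [GL] in [G] and [FL] meets [GR] in [G]. *)
Lemma sub_unstable_le i j k a b : mtype M = (false, i, j, k) ->
  named M a `<=` named M b -> unstable_le i j k a b.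
Proof.
move=> tM ab; have GGL : G M <> GL M by case: tM => /asboolP.
rewrite /unstable_le; have /and3P[-> Ej ->] := sub_stable_le tM ab.
have -> /= : generic_le NGL a ==> generic_le NGL b.
  apply: (splitting (q := NFR)) ab; first by case.
  move=> /= LF; apply: GGL; apply/seteqP; split=> x; first by case.
  by move=> Lx; apply: FR_GL => //; apply: LF.
have -> /= : generic_le NGR a ==> generic_le NGR b.
  apply: (splitting (q := NFL)) ab; first by case.
  move=> /= LF; apply: GGL; apply/GL_eq_GR/seteqP; split=> x; first by case.
  by move=> Lx; apply: FL_GR => //; apply: LF.
rewrite andbT /above_E; case: j tM Ej => /= tM; last by rewrite !orbF.
(* Here FLR = GLR, and a name that is not above E is below GL or GR. *)
move=> _; apply/implyP => Ea.
have {Ea} : named M NE `<=` named M a.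
  case/orP: Ea => [/generic_le_sub //|/eqP->].
  by apply/FLR_eq_GLR; case: tM => _ _ /asboolP.
move/subset_trans/(_ ab) => Eb; apply/negPn/negP => nEb.
have [e Ee e1] := nontrivial_idem GGL.
have /orP[] : generic_le b NGL || generic_le b NGR by case: (b) nEb.
  by move/generic_le_sub/(subset_trans Eb) => EL; apply/e1/E_GL/EL.
by move/generic_le_sub/(subset_trans Eb) => ER; apply/e1/E_GR/ER.
Qed.

Lemma Lambda_eq_sub i j k a b : mtype M = (false, i, j, k) ->
  Lambda_eq i j k a b -> named M a = named M b.
Proof.
move=> tM; elim=> [c d|c|c d _ ->|c d e _ -> _ ->] //; apply: coincidence_eq.
by rewrite tM; congr (_, _, _, _); case: tM.
Qed.

Lemma Lambda_le_sub i j k a b : mtype M = (false, i, j, k) ->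
  Lambda_le i j k a b -> named M a `<=` named M b.
Proof.
move=> tM; elim=> [c d [/inclusion_sub //|/(Lambda_eq_sub tM) ->]|c|c d e _ cd _ de].
- exact: subset_refl.
- exact: subset_refl.
- exact: subset_trans de.
Qed.

End Orders.

(** * The two diagrams *)

Lemma unstable_lattice_type (M : monoidType) i j k :
  mtype M = (false, i, j, k) -> unstable_lattice M i j k.
Proof.
move=> tM; split=> a b; split.
- move=> ab; apply: unstable_le_anti; apply: (sub_unstable_le tM); rewrite ab;
  exact: subset_refl.
- exact: Lambda_eq_sub.
- by move/(sub_unstable_le tM)/unstable_le_Lambda.
- exact: Lambda_le_sub.
Qed.

Section StableLattice.
Variables (M : monoidType) (i j k : bool).
Hypothesis tM : mtype M = (true, i, j, k).

Lemma stable_subP a b : (named M a `<=` named M b) <-> stable_le i j k a b.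
Proof. by split; [apply: (sub_stable_le tM)|apply: stable_le_sub]. Qed.

Lemma stable_eqP a b :
  (named M a = named M b) <-> stable_le i j k a b && stable_le i j k b a.
Proof.
split=> [ab|/andP[/stable_subP ab /stable_subP ba]]; last exact/seteqP.
by apply/andP; split; apply/stable_subP; rewrite ab; apply: subset_refl.
Qed.

Lemma stable_properP a b :
  (named M a `<` named M b) <-> stable_le i j k a b && ~~ stable_le i j k b a.
Proof.
split=> [[/stable_subP-> ba]|/andP[/stable_subP ab /negP ba]].
  by apply/negP => /stable_subP.
by split=> // /stable_subP.
Qed.


Ltac name_of X :=
  lazymatch X with
  | [set 1] => N1 | E _ => NE | G _ => NG | F _ => NF | setT => NM
  end.

Lemma stable_diagram_type : stable_diagram M i j k.
Proof.
have sub := stable_subP; have eq := stable_eqP; have proper := stable_properP.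
rewrite /stable_diagram.
case: i j k sub eq proper => -[] [] sub eq proper;
repeat match goal with
| |- and _ _ => split
| |- and3 _ _ _ => split
| |- and4 _ _ _ _ => split
end;
lazymatch goal with
| |- ?X = ?Y =>
  let a := name_of X in let b := name_of Y in exact/(eq a b)
| |- ?X `<` ?Y =>
  let a := name_of X in let b := name_of Y in exact/(proper a b)
| |- ~ (?X `<=` ?Y) =>
  let a := name_of X in let b := name_of Y in by move/(sub a b)
end.
Qed.

Lemma stable_lattice_type : stable_lattice M i j k.
Proof.
have [GL_G GR_G GLR_G] : [/\ GL M = G M, GR M = G M & GLR M = G M].
  by split; [apply/(stable_eqP NGL NG)|apply/(stable_eqP NGR NG)
    |apply/(stable_eqP NGLR NG)]; case: i j k => -[] [].
have [FL_F FR_F FLR_F] : [/\ FL M = F M, FR M = F M & FLR M = F M].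
  by split; [apply/(stable_eqP NFL NF)|apply/(stable_eqP NFR NF)
    |apply/(stable_eqP NFLR NF)]; case: i j k => -[] [].
split; [by split; congruence|by split; congruence| |exact: stable_diagram_type].
apply/seteqP; split=> [_ [a _ <-]|X]; last first.
  by case=> [[[[]|]|]|] ->; [exists N1|exists NE|exists NG|exists NF|exists NM].
case: a => /=; rewrite ?GL_G ?GR_G ?GLR_G ?FL_F ?FR_F ?FLR_F /setU /=; tauto.
Qed.

End StableLattice.

(** * Isomorphism types *)

Section Isomorphism.
Variable M : monoidType.

(** The names parametrize both posets, with repetitions, and the two preorders
    that they induce on the names agree. *)
Lemma LL_iso_range (U : Type) (q : name -> U) (leB : U -> U -> Prop) :
  (forall a b, named M a `<=` named M b <-> leB (q a) (q b)) ->
  (forall a b, leB (q a) (q b) -> leB (q b) (q a) -> q a = q b) ->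
  LL_iso M (range q) leB.
Proof.
move=> qP anti; have qq a : leB (q a) (q a) by apply/qP; apply: subset_refl.
pose f X := if pselect (exists a, named M a = X) is left e
            then q (projT1 (cid e)) else q N1.
have fE a : f (named M a) = q a.
  rewrite /f; case: pselect => [e|[]]; last by exists a.
  by case: cid => b /= ba; apply: anti; apply/qP; rewrite ba; apply: subset_refl.
exists f; split; last by move=> _ _ [a _ <-] [b _ <-]; rewrite !fE; apply: qP.
split.
- by move=> _ [a _ <-]; rewrite fE; exists a.
- move=> _ _ /set_mem[a _ <-] /set_mem[b _ <-]; rewrite !fE => ab.
  by apply/seteqP; split; apply/qP; rewrite ab.
- by move=> _ [a _ <-]; exists (named M a); [exists a|].
Qed.

Lemma Lambda_iso i j k : mtype M = (false, i, j, k) ->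
  LL_iso M (Lambda i j k) (Lambda_order i j k).
Proof.
move=> tM; have [eqP leP] := unstable_lattice_type tM.
have cls a b : Lambda_eq i j k a b ->
    [set c | Lambda_eq i j k a c] = [set c | Lambda_eq i j k b c].
  move=> /eqP ab; apply/seteqP; split=> c /eqP H; apply/eqP; congruence.
have ordP a b : named M a `<=` named M b <->
    Lambda_order i j k [set c | Lambda_eq i j k a c] [set c | Lambda_eq i j k b c].
  split=> [/leP ab|[c [d [/= /eqP -> /eqP -> /leP //]]]].
  by exists a, b; split=> //; apply: rst_refl.
apply: (LL_iso_range ordP) => a b /ordP ab /ordP ba.
by apply/cls/eqP/seteqP.
Qed.

Lemma LL_iso_onto (U : Type) (q : name -> U) (leB : U -> U -> Prop) i j k :
  mtype M = (true, i, j, k) ->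
  (forall a b, stable_le i j k a b <-> leB (q a) (q b)) ->
  (forall a b, leB (q a) (q b) -> leB (q b) (q a) -> q a = q b) ->
  (forall u, exists a, q a = u) -> LL_iso M [set: U] leB.
Proof.
move=> tM qP anti onto; have <- : range q = [set: U].
  by apply/seteqP; split=> // u _; have [a <-] := onto u; exists a.
apply: LL_iso_range anti => a b; rewrite -qP; exact: (stable_subP tM).
Qed.

(** The number of effective primes below [a]; it is the height of [named M a] in
    the lattice when the latter is a chain. *)
Definition rank i j k a : nat :=
  (~~ k && generic_le NG a) + (~~ j && generic_le NE a) + (~~ i && generic_le NM a).

(** [G] and [E] are the only incomparable members of the stable diagram, so it is
    a chain as soon as one of them is trivial. *)
Lemma stable_chain i j k : mtype M = (true, i, j, k) -> j || k ->
  LL_iso M [set: 'I_(~~ i + ~~ j + ~~ k).+1] (@chain_le _).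
Proof.
move=> tM jk; set n := (_ + _)%N.
have ltr a : rank i j k a < n.+1.
  by rewrite /n; case: i j k a {tM n} jk => -[] [] [].
have inK a : (inord (rank i j k a) : 'I_n.+1) = rank i j k a :> nat by apply: inordK.
apply: (LL_iso_onto (q := fun a => inord (rank i j k a)) tM).
- by move=> a b; rewrite /chain_le !inK; case: i j k a b {tM n ltr inK} jk => -[] [] [] [].
- by move=> a b; rewrite /chain_le => ab ba; apply/val_inj/eqP; rewrite eqn_leq ab.
case=> u ltu; suff [a ra] : exists a, rank i j k a = u.
  by exists a; apply: val_inj; rewrite /= inK.
(* An atom of the chain is G, E or M, whichever is the first nontrivial. *)
exists (if u is u'.+1 then
          if (u' == 0) && ~~ k then NG else if (u' == 0) && ~~ j then NE else NM
        else N1).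
by rewrite /n in ltu; case: i j k jk ltu {tM n ltr inK}; do 3?case; case: u => [|[|[|u]]].
Qed.

Lemma stable_square : mtype M = (true, true, false, false) ->
  LL_iso M [set: bool * bool] square_le.
Proof.
move=> tM; apply: (LL_iso_onto (q := fun a => (generic_le NG a, generic_le NE a)) tM).
- move=> a b; rewrite /square_le /=.
  by split=> [/and3P[/implyP ? /implyP ? _]|[/implyP ? /implyP ?]] //; apply/and3P.
- move=> a b [/= /implyP g1 /implyP e1] [/= /implyP g2 /implyP e2].
  by move: g1 e1 g2 e2; do 4!case: generic_le.
by case=> -[] []; [exists NF|exists NG|exists NE|exists N1].
Qed.

Lemma stable_square_top : mtype M = (true, false, false, false) ->
  LL_iso M [set: option (bool * bool)] (add_top_le square_le).
Proof.
move=> tM; apply: (LL_iso_onto (q := fun a => if generic_le NM a then None else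
  Some (generic_le NG a, generic_le NE a)) tM).
- move=> a b; rewrite /square_le; case: a b => -[] /=; cbv; intuition discriminate.
- by case=> -[]; cbv; intuition discriminate.
by case=> [[[] []]|]; [exists NF|exists NG|exists NE|exists N1|exists NM].
Qed.

End Isomorphism.

(** * Types of direct products *)

Section Product.
Variables A B : monoidType.
Let P : monoidType := (A * B)%type.

Let prodset (S : set A) (T : set B) : set P := [set x | S x.1 /\ T x.2].

(** Since [1] lies in every submonoid, [(x, y)] factors as [(x, 1) * (1, y)]; it
    is thus enough that the generators project to generators and that each
    generator of a factor embeds as a generator. *)
Lemma gen_prod (S : set P) (SA : set A) (SB : set B) :
  (forall x, S x -> SA x.1 /\ SB x.2) ->
  (forall x, SA x -> S (x, 1)) -> (forall y, SB y -> S (1, y)) ->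
  gen S = prodset (gen SA) (gen SB).
Proof.
move=> SAB SA1 S1B; apply/seteqP; split=> [x|[x y] [/= gx gy]].
  apply: gen_ind x => [|s x /SAB[sA sB] [xA xB]]; first by split; apply: gen1.
  by split; apply: genM => //; apply: sub_gen.
have -> : (x, y) = ((x, 1) * (1, y) : P).
  by congr pair; rewrite ?mulg1 ?mul1g.
apply: genM.
  move: x gx; apply: gen_ind => [|s x /SA1 Ss gx]; first exact: gen1.
  have -> : (s * x, 1) = ((s, 1) * (x, 1) : P) by congr pair; rewrite mulg1.
  by apply: genM => //; apply: sub_gen.
move: y gy; apply: gen_ind => [|s y /S1B Ss gy]; first exact: gen1.
have -> : (1, s * y) = ((1, s) * (1, y) : P) by congr pair; rewrite mulg1.
by apply: genM => //; apply: sub_gen.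
Qed.

Lemma GL_prod : GL P = prodset (GL A) (GL B).
Proof.
apply/seteqP; split=> [[x y] [[a b] [ax b_y]]|[x y] [[a ax] [b b_y]]].
  by split; [exists a|exists b].
by exists (a, b); congr pair.
Qed.

Lemma GR_prod : GR P = prodset (GR A) (GR B).
Proof.
apply/seteqP; split=> [[x y] [[a b] [xa yb]]|[x y] [[a xa] [b yb]]].
  by split; [exists a|exists b].
by exists (a, b); congr pair.
Qed.

Lemma E_prod : E P = prodset (E A) (E B).
Proof.
apply: gen_prod => [[e f] [ee ff] //|e ee|f ff]; by congr pair; rewrite ?mulg1.
Qed.

Lemma GLR_prod : GLR P = prodset (GLR A) (GLR B).
Proof.
apply: gen_prod => [x|x|y]; rewrite GL_prod GR_prod.
- by case=> -[]; split; [left|left|right|right].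
- by case=> ?; [left|right]; split=> //; exists 1; rewrite mulg1.
- by case=> ?; [left|right]; split=> //; exists 1; rewrite mulg1.
Qed.

Lemma FLR_prod : FLR P = prodset (FLR A) (FLR B).
Proof.
apply: gen_prod => [x|x|y]; rewrite E_prod GL_prod GR_prod.
- by case=> [[]|] []; split; by [left; left|left; right|right].
- case=> [[]|] ?; [left; left|left; right|right]; split=> //; 
    by [apply: gen1|exists 1; rewrite mulg1].
- case=> [[]|] ?; [left; left|left; right|right]; split=> //; 
    by [apply: gen1|exists 1; rewrite mulg1].
Qed.

(** Both products are nonempty, hence they determine their factors. *)
Lemma prodset_eq (S S' : set A) (T T' : set B) :
  S 1 -> S' 1 -> T 1 -> T' 1 ->
  `[< prodset S T = prodset S' T' >] = `[< S = S' >] && `[< T = T' >].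
Proof.
move=> S1 S'1 T1 T'1; apply/asboolP/andP => [/seteqP[ST ST']|[/asboolP-> /asboolP->]//].
split; apply/asboolP/seteqP; split=> x Hx.
- by have [] := ST (x, 1) (conj Hx T1).
- by have [] := ST' (x, 1) (conj Hx T'1).
- by have [] := ST (1, x) (conj S1 Hx).
- by have [] := ST' (1, x) (conj S'1 Hx).
Qed.

Lemma mtype_prod t i j k t' i' j' k' :
  mtype A = (t, i, j, k) -> mtype B = (t', i', j', k') ->
  mtype P = (t && t', i && i', j && j', k && k').
Proof.
case=> <- <- <- <- [<- <- <- <-].
have L1 (M : monoidType) : GL M 1 by exists 1; rewrite mulg1.
have R1 (M : monoidType) : GR M 1 by exists 1; rewrite mulg1.
have G1 (M : monoidType) : G M 1 by split.
have GP : G P = prodset (G A) (G B).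
  rewrite /G GL_prod GR_prod.
  by apply/seteqP; split=> x [] [? ?] [? ?].
have TP : [set: P] = prodset setT setT by apply/seteqP; split.
have oneP : [set 1 : P] = prodset [set 1] [set 1].
  by apply/seteqP; split=> [_ -> //|[x y] [/= -> ->]].
rewrite /mtype FLR_prod GLR_prod oneP GP GL_prod TP.
by rewrite !prodset_eq //; apply: gen1.
Qed.

End Product.


(** * Monoids of every type *)

Lemma mtype_group (M : monoidType) : (forall x, G M x) ->
  mtype M = (true, true, true, `[< forall x : M, x = 1 >]).
Proof.
move=> GT; have ET a b : generic_le NG a -> generic_le NG b -> named M a = named M b.
  move=> /generic_le_sub Ga /generic_le_sub Gb.
  by apply/seteqP; split=> x _; [apply: Gb|apply: Ga]; apply: GT.
congr (_, _, _, _).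
- exact/asboolP/(ET NG NGL).
- exact/asboolP/(ET NFLR NM).
- exact/asboolP/(ET NFLR NGLR).
apply: asbool_equiv_eq; split=> [G1 x|all1]; first by have := GT x; rewrite G1.
by apply/seteqP; split=> x _; [apply: all1|apply: GT].
Qed.

Lemma mtype_unitfree (M : monoidType) :
  (forall x : M, GL M x -> x = 1) -> (forall x : M, GR M x -> x = 1) ->
  mtype M = (true, `[< E M = setT >], `[< E M = [set 1] >], true).
Proof.
move=> L1 R1.
have EM : mtype M = (`[< G M = GL M >], `[< FLR M = setT >], `[< FLR M = GLR M >],
  `[< G M = [set 1] >]) by [].
have GL1 : GL M = [set 1] by apply/seteqP; split=> // _ ->; exists 1; rewrite mulg1.
have GR1 : GR M = [set 1] by apply/seteqP; split=> // _ ->; exists 1; rewrite mulg1.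
have G1 : G M = [set 1] by rewrite /G GL1 GR1 setIid.
have GLR1 : GLR M = [set 1].
  rewrite /GLR GL1 GR1 setUid -GL1; apply/seteqP; split; last exact: sub_gen.
  exact: (smallest_sub (@GL_submonoid M)).
have FLRE : FLR M = E M.
  apply/seteqP; split; last exact: (@generic_le_sub M NE NFLR).
  by apply: gen_sub => x; rewrite GL1 GR1 => -[[|->]|->] //; apply: gen1.
rewrite EM G1 GL1 GLR1 FLRE.
by congr (_, _, _, _); apply/asboolP.
Qed.

HB.instance Definition _ := @isMonoid.Build unit (fun _ _ => tt) tt
  (fun _ _ _ => erefl) (fun x => let: tt := x in erefl) (fun x => let: tt := x in erefl).

Lemma mtype_unit : mtype unit = (true, true, true, true).
Proof.
rewrite mtype_group => [|x]; last by split; exists 1.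
by congr (_, _, _, _); apply/asboolP; case.
Qed.

Lemma mtype_two_group : mtype (Algebra.to_multiplicative bool) = (true, true, true, false).
Proof.
rewrite mtype_group => [|x]; last by split; exists x; case: x.
by congr (_, _, _, _); apply/asboolP => /(_ true).
Qed.

(** A fresh name for [bool]: the monoid structure is conjunction, whereas the
    two-element group uses exclusive disjunction. *)
Definition semilattice : Type := bool.
HB.instance Definition _ := Choice.on semilattice.
HB.instance Definition _ := @isMonoid.Build semilattice andb true andbA andTb andbT.

Lemma mtype_semilattice : mtype semilattice = (true, true, false, true).
Proof.
rewrite mtype_unitfree; last 2 first.
- by case=> -[[] //].
- by case=> -[[] //].
have EE : E semilattice = setT.
  by apply/seteqP; split=> // x _; apply: sub_gen; apply: andbb.
rewrite EE; congr (_, _, _, _); first exact/asboolP.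
by apply/asboolP => /seteqP[/(_ false I)].
Qed.

Lemma mtype_nat : mtype (Algebra.to_multiplicative nat) = (true, false, true, true).
Proof.
rewrite mtype_unitfree; last 2 first.
- by move=> x [a /eqP]; rewrite addn_eq0 => /andP[_ /eqP].
- by move=> x [a /eqP]; rewrite addn_eq0 => /andP[/eqP].
have EE : E (Algebra.to_multiplicative nat) = [set 1].
  apply/seteqP; split; last by move=> _ ->; apply: gen1.
  apply: gen_ind => // s x ss ->; rewrite mulg1.
  by move: ss => /eqP; rewrite -[X in _ == X]addn0 eqn_add2l => /eqP.
rewrite EE; congr (_, _, _, _); last exact/asboolP.
by apply/asboolP => /seteqP[_ /(_ 1%N I)].
Qed.

Definition bicyclic : Type := (nat * nat)%type.
HB.instance Definition _ := Choice.on bicyclic.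

(** The pair [(a, b)] stands for the normal form [p ^ a * q ^ b] in the monoid
    presented by [q * p = 1]; truncated subtraction performs the cancellation of
    the inner factors [q ^ b * p ^ c]. *)
Definition bicyclic_mul (x y : bicyclic) : bicyclic :=
  (x.1 + (y.1 - x.2), y.2 + (x.2 - y.1))%N.

Lemma bicyclic_mulA : associative bicyclic_mul.
Proof.
by case=> [a b] [c d] [e f]; rewrite /bicyclic_mul /=; congr pair; lia.
Qed.

Lemma bicyclic_mul1 : left_id (0, 0)%N bicyclic_mul.
Proof. by case=> a b; rewrite /bicyclic_mul /= subn0 addn0. Qed.

Lemma bicyclic_1mul : right_id (0, 0)%N bicyclic_mul.
Proof. by case=> a b; rewrite /bicyclic_mul /= subn0 addn0. Qed.

HB.instance Definition _ :=
  @isMonoid.Build bicyclic bicyclic_mul (0, 0)%N bicyclic_mulA bicyclic_mul1 bicyclic_1mul.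

Lemma mtype_bicyclic : mtype bicyclic = (false, true, true, true).
Proof.
have L (a : nat) : GL bicyclic (a, 0%N).
  by exists (0%N, a); congr pair; rewrite /= subnn.
have R (b : nat) : GR bicyclic (0%N, b).
  by exists (b, 0%N); congr pair; rewrite /= subnn.
have GLRT : GLR bicyclic = setT.
  apply/seteqP; split=> // -[a b] _.
  have -> : (a, b) = ((a, 0%N) : bicyclic) * ((0%N, b) : bicyclic).
    by congr pair; rewrite /= ?subn0 ?addn0.
  by apply: genM; apply: sub_gen; [left|right].
have FLRT : FLR bicyclic = setT.
  apply/seteqP; split=> // x _; apply: (@generic_le_sub bicyclic NGLR NFLR) => //=.
  by rewrite GLRT.
have G1 : G bicyclic = [set 1].
  apply/seteqP; split=> [[a b] [[[c d] [_ /= b0]] [[e f] [/= a0 _]]]|_ ->].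
    by congr pair; lia.
  by split; exists 1; rewrite mulg1.
rewrite /mtype FLRT GLRT G1; congr (_, _, _, _); try exact/asboolP.
by apply/asboolP => /seteqP[_ /(_ (1%N, 0%N) (L _))].
Qed.

Lemma stable_type_exists i j k : exists M : monoidType, mtype M = (true, i, j, k).
Proof.
have fi : exists M : monoidType, mtype M = (true, i, true, true).
  by case: i; eexists; [exact: mtype_unit|exact: mtype_nat].
have fj : exists M : monoidType, mtype M = (true, true, j, true).
  by case: j; eexists; [exact: mtype_unit|exact: mtype_semilattice].
have fk : exists M : monoidType, mtype M = (true, true, true, k).
  by case: k; eexists; [exact: mtype_unit|exact: mtype_two_group].
have [[A tA] [B tB] [C tC]] := And3 fi fj fk.
exists (A * (B * C))%type.
by rewrite (mtype_prod tA (mtype_prod tB tC)) /= !andbT.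
Qed.

Lemma unstable_type_exists i j k :
  exists M : monoidType, mtype M = (false, i, j, k).
Proof.
have [A tA] := stable_type_exists i j k.
by exists (bicyclic * A)%type; rewrite (mtype_prod mtype_bicyclic tA).
Qed.

(** * The classification *)

Theorem theorem4p4 :
  (forall M : monoidType, stable_identity M ->
     exists i j k : bool,
       mtype M = (true, i, j, k) /\ stable_lattice M i j k) /\
  (forall M : monoidType, unstable_identity M ->
     exists i j k : bool,
       mtype M = (false, i, j, k) /\ unstable_lattice M i j k) /\
  ((forall i j k : bool, exists M : monoidType,
      mtype M = (true, i, j, k) /\ stable_lattice M i j k) /\
   (forall i j k : bool, exists M : monoidType,
      mtype M = (false, i, j, k) /\ unstable_lattice M i j k)) /\
  (forall M : monoidType,
     LL_iso M [set: 'I_1]%classic (@chain_le 1) \/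
     LL_iso M [set: 'I_2]%classic (@chain_le 2) \/
     LL_iso M [set: 'I_3]%classic (@chain_le 3) \/
     LL_iso M [set: bool * bool]%classic square_le \/
     LL_iso M [set: option (bool * bool)]%classic (add_top_le square_le) \/
     exists i j k : bool, LL_iso M (Lambda i j k) (Lambda_order i j k)).
Proof.
have mtypeE M : mtype M = (`[< stable_identity M >], (mtype M).1.1.2, (mtype M).1.2,
    (mtype M).2).
  by congr (_, _, _, _); apply: asbool_equiv_eq; rewrite stableP.
split.
  move=> M /asboolT st; have := mtypeE M; rewrite st => tM.
  by do 3!eexists; split; [exact: tM|exact: stable_lattice_type].
split.
  move=> M /asboolF st; have := mtypeE M; rewrite st => tM.
  by do 3!eexists; split; [exact: tM|exact: unstable_lattice_type].
split.
  split=> i j k.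
    have [M tM] := stable_type_exists i j k.
    by exists M; split=> //; apply: stable_lattice_type.
  have [M tM] := unstable_type_exists i j k.
  by exists M; split=> //; apply: unstable_lattice_type.
move=> M; case tM: (mtype M) => [[[[] i] j] k]; last first.
  by do 5!right; exists i, j, k; apply: Lambda_iso.
have := stable_chain tM.
case: i j k tM => -[] [] tM; do ?[by move/(_ isT); auto 6] => _.
  by do 3!right; left; apply: stable_square.
by do 4!right; left; apply: stable_square_top.
Qed.
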